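(* Let $1 \le p < \infty$ and let $X$ be an infinite-dimensional real Banach space isomorphic to a (closed) subspace of an $\ell_p$ sum $\big(\bigoplus_{i=1}^\infty E_i\big)_{\ell_p}$ of finite-dimensional real normed spaces $E_i$. Then $\Theta_X(n) \simeq n^{-1/p}$; that is, there are constants $c, d>0$ such that $c\, n^{-1/p} \le \Theta_X(n) \le d\, n^{-1/p}$ for all $n \in \mathbb{N}$.
   Context: $B_X$ is the closed unit ball of $X$. For $A \subset X$, the essential inradius $\varrho(A) \in [0,\infty]$ is $$\varrho(A) = \sup\{ r>0 : \exists x \in A,\ \exists Y \subset X \text{ closed subspace with } \dim(X/Y)<\infty,\ x + r B_Y \subset A\},$$ where $B_Y = B_X \cap Y$ (and $\sup \emptyset = 0$). Let $\mathcal{C}(X)$ be the family of bounded closed convex subsets of $X$. The covering index is $$\Theta_X(n) = \inf\Big\{ \max_{1\le k\le n} \varrho(A_k) : (A_k)_{k=1}^n \subset \mathcal{C}(X),\ \bigcup_{k=1}^n A_k = B_X \Big\}, \qquad n \in \mathbb{N}.$$ $\big(\bigoplus_{i} E_i\big)_{\ell_p}$ is the space of sequences $(x_i)$ with $x_i \in E_i$ and norm $\big(\sum_i \|x_i\|^p\big)^{1/p} < \infty$. *)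

(* Defs.v *)
From HB Require Import structures.
From mathcomp Require Import all_boot all_order all_algebra.
From mathcomp Require Import all_classical all_reals all_analysis.

Set Implicit Arguments.
Unset Strict Implicit.
Unset Printing Implicit Defensive.

Import Order.TTheory GRing.Theory Num.Theory.
Import numFieldNormedType.Exports.

Local Open Scope classical_set_scope.
Local Open Scope ring_scope.

Section FiniteDimension.
Context {R : realType}.

Definition finite_dimensional (V : lmodType R) : Prop :=
  exists (n : nat) (e : 'I_n -> V),
    forall v : V, exists c : 'I_n -> R, v = \sum_(i < n) c i *: e i.

(* dim (V / Y) < oo: the classes of finitely many vectors span the quotient
   V / Y, without forming the quotient type *)
Definition finite_codimensional (V : lmodType R) (Y : set V) : Prop :=
  exists (n : nat) (e : 'I_n -> V),
    forall v : V, exists c : 'I_n -> R, Y (v - \sum_(i < n) c i *: e i).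

End FiniteDimension.

Definition dprod (R : realType) (E : nat -> normedModType R) : Type :=
  forall i, E i.

Section DependentProduct.
Context {R : realType} (E : nat -> normedModType R).
Local Notation V := (dprod E).

HB.instance Definition _ := gen_eqMixin V.
HB.instance Definition _ := gen_choiceMixin V.

Let zero : V := fun=> 0.
Let opp (x : V) : V := fun i => - x i.
Let add (x y : V) : V := fun i => x i + y i.
Let scale (a : R) (x : V) : V := fun i => a *: x i.

Let addA : associative add.
Proof. by move=> x y z; apply: functional_extensionality_dep => i; exact: addrA. Qed.
Let addC : commutative add.
Proof. by move=> x y; apply: functional_extensionality_dep => i; exact: addrC. Qed.
Let add0 : left_id zero add.
Proof. by move=> x; apply: functional_extensionality_dep => i; exact: add0r. Qed.
Let addN : left_inverse zero opp add.
Proof. by move=> x; apply: functional_extensionality_dep => i; exact: addNr. Qed.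

HB.instance Definition _ := GRing.isZmodule.Build V addA addC add0 addN.

Let scaleA a b v : scale a (scale b v) = scale (a * b) v.
Proof. by apply: functional_extensionality_dep => i; exact: scalerA. Qed.
Let scale1 : left_id 1 scale.
Proof. by move=> x; apply: functional_extensionality_dep => i; exact: scale1r. Qed.
Let scaleDr : right_distributive scale +%R.
Proof. by move=> a x y; apply: functional_extensionality_dep => i; exact: scalerDr. Qed.
Let scaleDl v : {morph scale^~ v : a b / a + b}.
Proof. by move=> a b; apply: functional_extensionality_dep => i; exact: scalerDl. Qed.

HB.instance Definition _ :=
  GRing.Zmodule_isLmodule.Build R V scaleA scale1 scaleDr scaleDl.

Lemma dprod0E i : (0 : V) i = 0. Proof. by []. Qed.
Lemma dprodDE (x y : V) i : (x + y) i = x i + y i. Proof. by []. Qed.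
Lemma dprodZE (a : R) (x : V) i : (a *: x) i = a *: x i. Proof. by []. Qed.

End DependentProduct.

(* Locked: unification otherwise unfolds the series and diverges. *)
HB.lock Definition lp_mass (R : realType) (p : R) (E : nat -> normedModType R)
  (x : dprod E) : \bar R := (\sum_(i <oo) (`|x i| `^ p)%:E)%E.

HB.lock Definition lp_norm (R : realType) (p : R) (E : nat -> normedModType R)
  (x : dprod E) : R := fine (lp_mass p x) `^ p^-1.

Section LpSum.
Context {R : realType} (p : R) (p1 : 1 <= p) (E : nat -> normedModType R).
Implicit Types x y : dprod E.

Local Notation lp_mass := (lp_mass p).

Definition lp_summable : {pred dprod E} := mem [set x | (lp_mass x < +oo)%E].

Let p0 : 0 < p. Proof. exact: lt_le_trans p1. Qed.
Let pn0 : p != 0. Proof. by rewrite gt_eqF. Qed.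

Let N (f : nat -> R) : \bar R := Lnorm counting p%:E (EFin \o f).

Let NE x : N (fun i => `|x i|) = (lp_mass x `^ p^-1)%E.
Proof.
rewrite /N Lnorm_counting//; congr poweR; rewrite lp_mass.unlock.
by apply: eq_eseriesr => i _; rewrite /= normr_id.
Qed.

Lemma lp_mass_ge0 x : (0 <= lp_mass x)%E.
Proof.
rewrite lp_mass.unlock; apply: nneseries_ge0 => i _ _.
by rewrite lee_fin powR_ge0.
Qed.

Let lp_massD x y :
  (lp_mass (x + y)%R `^ p^-1 <= lp_mass x `^ p^-1 + lp_mass y `^ p^-1)%E.
Proof.
rewrite -!NE.
apply: le_trans (@minkowski_EFin _ _ R (@counting nat R) (fun i => `|x i|)
  (fun i => `|y i|) p _ _ p1) => //.
rewrite /N !Lnorm_counting//.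
apply: gt0_ler_poweR; rewrite ?invr_ge0 ?(ltW p0)//.
- rewrite in_itv/= leey andbT.
  by apply: nneseries_ge0 => i _ _; rewrite lee_fin powR_ge0.
- rewrite in_itv/= leey andbT.
  by apply: nneseries_ge0 => i _ _; rewrite lee_fin powR_ge0.
apply: lee_nneseries => i _; first by rewrite lee_fin powR_ge0.
rewrite /= lee_fin ge0_ler_powR ?(ltW p0)// ?nnegrE//.
by rewrite normr_id [leRHS]ger0_norm ?addr_ge0// dprodDE ler_normD.
Qed.

Let lp_massZ (a : R) x : lp_mass (a *: x) = ((`|a| `^ p)%:E * lp_mass x)%E.
Proof.
rewrite lp_mass.unlock -nneseriesZl; last first.
  by move=> i _; rewrite lee_fin powR_ge0.
by apply: eq_eseriesr => i _; rewrite dprodZE normrZ powRM// EFinM.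
Qed.

Let lp_mass0 : lp_mass (0 : dprod E) = 0%E.
Proof.
rewrite lp_mass.unlock; apply: eseries0 => i _ _.
by rewrite dprod0E normr0 powR0.
Qed.

Let lp_massV_lty x : (lp_mass x `^ p^-1 < +oo)%E = (lp_mass x < +oo)%E.
Proof.
apply/idP/idP => [|h]; last exact: poweR_lty.
by apply: lty_poweRy; rewrite invr_eq0.
Qed.

Lemma lp_summable_submod_closed : submod_closed lp_summable.
Proof.
split; first by rewrite inE/= lp_mass0 ltry.
move=> a x y; rewrite !inE/= => hx hy.
rewrite -lp_massV_lty (le_lt_trans (lp_massD _ _))// lte_add_pinfty//.
  by rewrite lp_massV_lty lp_massZ lte_mul_pinfty// lee_fin powR_ge0.
by rewrite lp_massV_lty.
Qed.

HB.instance Definition _ :=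
  GRing.isSubmodClosed.Build R (dprod E) lp_summable lp_summable_submod_closed.

(* The proof of 1 <= p is a parameter of the type because lp_norm satisfies the
   triangle inequality only for such p. *)
Record lp_sum (q : 1 <= p) : Type :=
  LpSum { lp_seq :> dprod E ; lp_seqP : lp_seq \in lp_summable }.
Local Notation L := (lp_sum p1).

HB.instance Definition _ := [isSub for @lp_seq p1].
HB.instance Definition _ := [Choice of L by <:].
HB.instance Definition _ := [SubChoice_isSubLmodule of L by <:].

Lemma lp_seq0 : lp_seq (0 : L) = 0. Proof. exact: (raddf0 (val : L -> _)). Qed.
Lemma lp_seqD (x y : L) : lp_seq (x + y) = lp_seq x + lp_seq y.
Proof. exact: (raddfD (val : L -> _)). Qed.
Lemma lp_seqZ (a : R) (x : L) : lp_seq (a *: x) = a *: lp_seq x.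
Proof. exact: (linearZ_LR (val : L -> _)). Qed.

Let lp_mass_fin (x : L) : lp_mass x \is a fin_num.
Proof. by rewrite ge0_fin_numE ?lp_mass_ge0//; have := lp_seqP x; rewrite inE. Qed.

Let lp_normE (x : L) : (lp_norm p x)%:E = (lp_mass x `^ p^-1)%E.
Proof. by rewrite lp_norm.unlock -poweR_EFin fineK. Qed.

Let norm (x : L) : R := lp_norm p x.

Let ler_normD (x y : L) : norm (x + y) <= norm x + norm y.
Proof. by rewrite -lee_fin EFinD !lp_normE lp_seqD; exact: lp_massD. Qed.

Let normZ (a : R) (x : L) : norm (a *: x) = `|a| * norm x.
Proof.
rewrite /norm lp_norm.unlock lp_seqZ lp_massZ fineM// powRM ?powR_ge0//.
  by rewrite -powRrM mulfV// powRr1.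
by rewrite fine_ge0// lp_mass_ge0.
Qed.

Let norm0_eq0 (x : L) : norm x = 0 -> x = 0.
Proof.
rewrite /norm lp_norm.unlock => /powR_eq0_eq0 /eqP.
rewrite fine_eq0// => /eqP x0.
apply/val_inj/functional_extensionality_dep => i.
apply/normr0_eq0/(@powR_eq0_eq0 _ _ p)/eqP; rewrite eq_le powR_ge0 andbT.
rewrite -lee_fin -[leRHS]/0%E -x0 lp_mass.unlock.
rewrite (nneseriesD1 (n := i))// ?leeDl//.
by apply: nneseries_ge0 => j _ _; rewrite lee_fin powR_ge0.
Qed.

HB.instance Definition _ :=
  Lmodule_isNormed.Build R L ler_normD normZ norm0_eq0.

Lemma lp_sum_normE (x : L) : `|x| = lp_norm p x. Proof. by []. Qed.

End LpSum.

Section Embedding.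
Context {R : realType}.

(* For a linear T, bounds a and b as below say exactly that T is a linear
   homeomorphism of X onto range T. *)
Definition isomorphic_to_closed_subspace (X Z : normedModType R) : Prop :=
  exists T : {linear X -> Z}, closed (range T) /\
    exists a b : R, [/\ 0 < a, 0 < b &
      forall x, a * `|x| <= `|T x| <= b * `|x|].

End Embedding.

Section CoveringIndex.
Context {R : realType} (X : normedModType R).

Definition unit_ball : set X := [set x | `|x| <= 1].

(* 0 is added to the set because the supremum is taken in [0, +oo], whereas
   ereal_sup set0 = -oo. *)
Definition essential_inradius (A : set X) : \bar R :=
  ereal_sup (0%E |` [set r%:E | r in [set r : R | 0 < r /\
    exists (x : X) (Y : set X),
      [/\ A x, closed Y, submod_closed (mem Y), finite_codimensional Y &
          [set x + r *: y | y in unit_ball `&` Y] `<=` A]]]).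

Definition bounded_closed_convex (A : set X) : Prop :=
  [/\ bounded_set A, closed A & @convex_set R X A].

(* For 0 < n the index -oo of the iterated maximum plays no role. *)
Definition covering_index (n : nat) : \bar R :=
  ereal_inf [set (\big[maxe/-oo]_(k < n) essential_inradius (A k))%E |
    A in [set A : 'I_n -> set X |
      (forall k, bounded_closed_convex (A k)) /\
      \bigcup_k A k = unit_ball]].

End CoveringIndex.

(* Main.v *)
From HB Require Import structures.
Require Import Defs.
From mathcomp Require Import all_boot all_order all_algebra.
From mathcomp Require Import all_classical all_reals all_analysis.
From mathcomp Require Import lra.
Import Order.TTheory GRing.Theory Num.Theory.
Import numFieldNormedType.Exports.
Local Open Scope classical_set_scope.
Local Open Scope ring_scope.

(** Let [T] embed [X] into the l_p sum [Z], with
    [a * `|x| <= `|T x| <= b * `|x|].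

    Lower estimate.  Suppose that convex sets [A_1, ..., A_n] cover the unit
    ball and that all have essential inradius less than a small multiple [r] of
    [n ^ (-1/p)].  Start from [x = 0].  If [x] lies in [A_k], then every closed
    subspace of finite codimension contains a [y] in the unit ball such that
    [x + r y] is not in [A_k].  By Hahn-Banach a closed hyperplane [H] satisfies
    [x + r y + H] disjoint from [A_k], so all later steps, if taken inside [H],
    stay out of [A_k].  After [n] steps the point has left all the sets
    ([thin_cover_escape]).  It is still in the unit ball: each step is taken in
    the subspace of vectors whose image has vanishing first coordinates, hence
    almost disjoint from what was built before, so p-th powers of norms add up
    and [n] steps of length [r] produce a vector of norm at most
    about [n ^ (1/p) * r].  The required form of Hahn-Banach
    ([separating_hyperplane]) is obtained from a maximal convex cone.

    Upper estimate.  A gliding hump argument gives unit vectors [x_0, x_1, ...]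
    of [X] whose images are concentrated on consecutive blocks of coordinates.
    Colour the blocks cyclically with [n] colours and let [q_k x] be the norm of
    the part of [T x] in colour [k].  Since the sum of the [q_k x ^ p] is
    [`|T x| ^ p], the sets [A_k] of the [x] in the unit ball with
    [q_k x <= b * n ^ (-1/p)] cover the ball ([restr_colour_sum]).  A subspace
    of finite codimension contains a nontrivial combination of vectors [x_j] of
    colour [k], and for such a vector [q_k] is comparable to the norm
    ([colour_detects]); by symmetry [x + r y] and [x - r y] cannot both stay in
    [A_k] unless [r] is at most a multiple of [n ^ (-1/p)]. *)

(** * Subspaces of finite codimension *)

Definition is_subspace {R : realType} {V : lmodType R} (Y : set V) : Prop :=
  submod_closed (mem Y).

Lemma is_subspaceP {R : realType} {V : lmodType R} (Y : set V) :
  is_subspace Y <-> Y 0 /\ forall a x y, Y x -> Y y -> Y (a *: x + y).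
Proof.
split=> -[Y0 YD]; split.
- by move: Y0; rewrite inE.
- by move=> a x y Yx Yy; have := YD a x y; rewrite !inE; exact.
- by rewrite inE.
- by move=> a x y; rewrite !inE; exact: YD.
Qed.

Section Subspaces.
Context {R : realType} {V : lmodType R}.
Implicit Types Y : set V.

Lemma subspace0 Y : is_subspace Y -> Y 0.
Proof. by case/is_subspaceP. Qed.

Lemma subspaceP Y : is_subspace Y ->
  forall a x y, Y x -> Y y -> Y (a *: x + y).
Proof. by case/is_subspaceP. Qed.

Lemma subspaceZ Y : is_subspace Y -> forall a x, Y x -> Y (a *: x).
Proof.
move=> Ys a x Yx; rewrite -[_ *: _]addr0; apply: subspaceP => //.
exact: subspace0.
Qed.

Lemma subspaceD Y : is_subspace Y -> forall x y, Y x -> Y y -> Y (x + y).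
Proof. by move=> Ys x y Yx Yy; rewrite -[x]scale1r; exact: subspaceP. Qed.

Lemma subspace_sum Y n (v : 'I_n -> V) : is_subspace Y ->
  (forall i, Y (v i)) -> Y (\sum_(i < n) v i).
Proof.
move=> Ys Yv; elim/big_ind : _ => //; first exact: subspace0.
exact: subspaceD.
Qed.

Lemma subspace_setT : is_subspace (@setT V).
Proof. by apply/is_subspaceP; split. Qed.

Lemma subspaceI Y Y' : is_subspace Y -> is_subspace Y' ->
  is_subspace (Y `&` Y').
Proof.
move=> Ys Ys'; apply/is_subspaceP; split.
  by split; exact: subspace0.
by move=> a x y [? ?] [? ?]; split; exact: subspaceP.
Qed.

Lemma fcodim_setT : finite_codimensional (@setT V).
Proof. by exists 0%N, (fun _ => 0) => v; exists (fun _ => 0). Qed.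

(** [u] is the one additional generator that is needed for the quotient by
    [Y']. *)
Lemma fcodim_hyperplane Y Y' (u : V) : finite_codimensional Y ->
  (forall x, Y x -> exists c, Y' (x - c *: u)) -> finite_codimensional Y'.
Proof.
move=> [n [e Ye]] Yu.
exists n.+1, (fun i => oapp e u (unlift ord_max i)) => v.
have [c Yc] := Ye v; have [d Yd] := Yu _ Yc.
exists (fun i => oapp c d (unlift ord_max i)).
rewrite big_ord_recr/= unlift_none/= opprD addrA.
under eq_bigr => i _.
  have -> : widen_ord (leqnSn n) i = lift ord_max i.
    by apply/val_inj; rewrite /= /bump leqNgt ltn_ord.
  rewrite liftK/=; over.
exact: Yd.
Qed.

Lemma fcodim_sub Y Y' : Y `<=` Y' ->
  finite_codimensional Y -> finite_codimensional Y'.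
Proof.
move=> YY' [n [e Ye]]; exists n, e => v.
by have [c /YY'] := Ye v; exists c.
Qed.

(** The spanning vector [u] of the quotient by [H] may lie outside [Y].  If some
    [y] in [Y] has a nonzero component along [u], it takes over the role of [u];
    otherwise [Y] is contained in [H]. *)
Lemma fcodim_capH Y H (u : V) : is_subspace Y -> is_subspace H ->
  (forall x, exists c, H (x - c *: u)) -> finite_codimensional Y ->
  finite_codimensional (Y `&` H).
Proof.
move=> Ys Hs Hu Yf.
have [[y [c [Yy c0 Hy]]]|noy] := pselect (exists y c,
    [/\ Y y, c != 0 & H (y - c *: u)]).
- apply: (fcodim_hyperplane Y _ y Yf) => x Yx; have [d Hd] := Hu x.
  exists (d / c); split; first by rewrite addrC -scaleNr; exact: subspaceP.
  have -> : x - (d / c) *: y = - (d / c) *: (y - c *: u) + (x - d *: u).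
    rewrite scalerBr scalerA mulNr divfK// scaleNr scaleNr opprK addrACA.
    by rewrite subrr addr0 addrC.
  exact: subspaceP.
- apply: fcodim_sub Yf => x Yx; split => //; have [d Hd] := Hu x.
  have [d0|d0] := eqVneq d 0; first by rewrite -[x]subr0 -(scale0r u) -d0.
  by exfalso; apply: noy; exists x, d.
Qed.

(** Descend through the subspaces [Z k] of the [x] in [Y] whose image is spanned
    by the first [k] of the [m] generators of [W]: each step costs at most one
    dimension, [Z m = Y], and [g] vanishes on [Z 0].  The generators need not be
    independent, so no coordinate functionals on [W] are used. *)
Lemma fcodim_ker Y (W : lmodType R) (g : {linear V -> W}) :
  finite_dimensional W -> is_subspace Y -> finite_codimensional Y ->
  finite_codimensional (Y `&` [set x | g x = 0]).
Proof.
move=> [m [w Ww]] Ys Yf.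
pose Z k := Y `&` [set x | exists2 c : 'I_m -> R,
  (forall i : 'I_m, (k <= i)%N -> c i = 0) & g x = \sum_(i < m) c i *: w i].
suff : finite_codimensional (Z 0%N).
  apply: fcodim_sub => x [Yx [c c0 gx]]; split => //=.
  by rewrite gx big1// => i _; rewrite c0 ?scale0r.
have Zm : finite_codimensional (Z m).
  apply: fcodim_sub Yf => x Yx; split => //=.
  by have [c ->] := Ww (g x); exists c => // i; rewrite leqNgt ltn_ord.
suff H k : (k <= m)%N -> finite_codimensional (Z (m - k)%N).
  by rewrite -(subnn m); exact: H.
elim: k => [|k IH] km; first by rewrite subn0.
have {IH} := IH (ltnW km).
rewrite -(subnSK km).
have jm : (m - k.+1 < m)%N by rewrite ltn_subrL/= (leq_trans _ km).
move: (m - k.+1)%N jm => j jm.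
pose oj := Ordinal jm.
have [[u [Yu [cu [cu0 gu cuj]]]]|noU] := pselect (exists u, Y u /\ exists cu,
   [/\ forall i : 'I_m, (j < i)%N -> cu i = 0,
     g u = \sum_(i < m) cu i *: w i & cu oj != 0]).
- move=> Zj; apply: (fcodim_hyperplane _ _ u Zj) => /= x [Yx [c c0 gx]].
  exists (c oj / cu oj); split.
    by rewrite -scaleN1r scalerA addrC; exact: subspaceP.
  exists (fun i => c i - c oj / cu oj * cu i).
    move=> i; rewrite leq_eqVlt => /predU1P[ji|ji].
      have -> : i = oj by apply/val_inj; rewrite /= ji.
      by rewrite divfK// subrr.
    by rewrite c0// (cu0 i)// mulr0 subrr.
  rewrite linearB linearZ/= gx gu scaler_sumr -sumrB; apply: eq_bigr => i _.
  by rewrite scalerBl scalerA.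
- apply: fcodim_sub => x [Yx [c c0 gx]]; split => //; exists c => // i.
  rewrite leq_eqVlt => /predU1P[ji|]; last exact: c0.
  have -> : i = oj by apply/val_inj; rewrite /= ji.
  apply/eqP/negP => /negP cj; apply: noU; exists x; split => //.
  by exists c.
Qed.

Lemma fcodim_nonzero Y : ~ finite_dimensional V -> finite_codimensional Y ->
  exists2 y, Y y & y != 0.
Proof.
move=> Vinf [n [e Ye]]; apply: contrapT => Y0; apply: Vinf.
exists n, e => v; have [c Yc] := Ye v; exists c; apply/eqP; rewrite -subr_eq0.
by apply/negP => /negP v0; apply: Y0; exists (v - \sum_(i < n) c i *: e i).
Qed.

(** More vectors than the quotient has generators are dependent modulo [Y]; the
    coefficients come from the kernel of the matrix of their coordinates. *)
Lemma fcodim_comb Y : is_subspace Y -> finite_codimensional Y ->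
  exists n, forall v : 'I_n -> V, exists2 l : 'I_n -> R,
    Y (\sum_(i < n) l i *: v i) & exists i, l i != 0.
Proof.
move=> Ys [n [e Ye]]; exists n.+1 => v.
pose c i := projT1 (cid (Ye (v i))).
have Yc i : Y (v i - \sum_(j < n) c i j *: e j) := projT2 (cid (Ye (v i))).
pose M := \matrix_(i < n.+1, j < n) c i j.
have : kermx M != 0.
  rewrite kermx_eq0 /row_free; apply/eqP => Mr.
  by have := rank_leq_col M; rewrite Mr ltnn.
move=> /rowV0Pn[l /sub_kermxP lM l0].
exists (l ord0); last first.
  apply: contrapT => nl; move/eqP: l0; apply; apply/rowP => i; rewrite mxE.
  by apply/eqP/negP => /negP li; apply: nl; exists i.
have -> : \sum_(i < n.+1) l ord0 i *: v i =
    \sum_(i < n.+1) l ord0 i *: (v i - \sum_(j < n) c i j *: e j).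
  under [in RHS]eq_bigr do rewrite scalerBr scaler_sumr.
  rewrite sumrB exchange_big/= [X in _ - X]big1 ?subr0// => j _.
  under eq_bigr do rewrite scalerA.
  rewrite -scaler_suml; have /matrixP/(_ ord0 j) := lM.
  rewrite !mxE => lMj; rewrite -[X in X *: _]/(\sum_(i < n.+1) _).
  by rewrite (eq_bigr (fun i => l ord0 i * M i j)) ?lMj ?scale0r// => i _; rewrite mxE.
by apply: subspace_sum => // i; exact: subspaceZ.
Qed.

End Subspaces.

(** * Closed and convex sets in a normed space *)

Section NormTopology.
Context {R : realType} {X : normedModType R}.
Implicit Types A : set X.

Lemma closed_dist A :
  (forall x, (forall e, 0 < e -> exists2 y, A y & `|x - y| < e) -> A x) ->
  closed A.
Proof.
move=> clA x clx; apply: clA => e e0.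
have [y [Ay xy]] := clx _ (nbhsx_ballx x e e0).
by exists y => //; move: xy; rewrite -ball_normE.
Qed.

Lemma closed_avoid A z : closed A -> ~ A z ->
  exists2 d, 0 < d & forall x, A x -> d <= `|x - z|.
Proof.
move=> /closed_openC Ao Az.
have /nbhs_ballP[d/= d0 dA] : nbhs z (~` A) by exact: open_nbhs_nbhs.
exists d => // x Ax; rewrite leNgt; apply/negP => xz; apply: (dA x) => //.
by rewrite -ball_normE/= distrC.
Qed.

Lemma convex_setP A : @convex_set R X A <->
  forall x y t, 0 <= t <= 1 -> A x -> A y -> A (t *: x + (1 - t) *: y).
Proof.
split=> cA x y t.
  move=> /andP[t0 t1] Ax Ay.
  have := cA x y (@Itv01 R t t0 t1); rewrite !inE; exact.
by rewrite !inE => Ax Ay; apply: cA => //; apply/andP.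
Qed.

Lemma closed_sublevel (q : X -> R) L t : 0 < L ->
  (forall x y, q x - q y <= L * `|x - y|) -> closed [set x | q x <= t].
Proof.
move=> L0 qL; apply: closed_dist => x xt /=; rewrite leNgt; apply/negP => tx.
have [|y /= yt xy] := xt ((q x - t) / L); first by rewrite divr_gt0// subr_gt0.
move: xy; rewrite ltr_pdivlMr// mulrC ltNge => /negP; apply.
by apply: le_trans (qL x y); rewrite lerB.
Qed.

Lemma convex_sublevel (q : X -> R) t :
  (forall x y, q (x + y) <= q x + q y) ->
  (forall s x, 0 <= s -> q (s *: x) = s * q x) ->
  @convex_set R X [set x | q x <= t].
Proof.
move=> qD qZ; apply/convex_setP => x y s /andP[s0 s1] /= xt yt.
have s'0 : 0 <= 1 - s by rewrite subr_ge0.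
apply: le_trans (qD _ _) _; rewrite !qZ//.
have -> : t = s * t + (1 - s) * t by rewrite -mulrDl addrCA subrr addr0 mul1r.
by rewrite lerD// ler_wpM2l.
Qed.

Lemma convex_setI A B : @convex_set R X A -> @convex_set R X B ->
  @convex_set R X (A `&` B).
Proof.
move=> /convex_setP Ac /convex_setP Bc; apply/convex_setP => x y t t01.
by move=> [Ax Bx] [Ay By]; split; [exact: Ac|exact: Bc].
Qed.

End NormTopology.

(** * Separation by a closed hyperplane *)

Section Separation.
Context {R : realType} {V : lmodType R}.
Implicit Types P K : set V.

Definition convex_cone P : Prop :=
  (forall x y, P x -> P y -> P (x + y)) /\
  (forall t x, 0 < t -> P x -> P (t *: x)).

(** The last clause says that, up to its boundary, a maximal cone is a half
    space.  If [- x] is not in [P], then [P] with the ray through [x] added still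
    generates a cone without [0], so by maximality it is [P]. *)
Lemma maximal_cone K : convex_cone K -> K !=set0 -> ~ K 0 ->
  exists P, [/\ convex_cone P, K `<=` P, ~ P 0 &
    forall x, P (- x) \/ forall q, P q -> P (q + x)].
Proof.
move=> Kc Kn K0.
(* [set0] is put in [Q] because it is the union of the empty chain. *)
pose Q := [set D : set V | [/\ convex_cone D, ~ D 0 & D = set0 \/ K `<=` D]].
have [|P [[Pc P0 PK] Pmax]] := @Zorn_bigcup V Q.
  move=> F FQ Ftot; split.
  - split=> [x y [D FD Dx] [D' FD' D'y]|t x t0 [D FD Dx]]; last first.
      by exists D => //; have [[_ DZ] _ _] := FQ _ FD; exact: DZ.
    have [DD'|D'D] := Ftot _ _ FD FD'.
      by exists D' => //; have [[DD _] _ _] := FQ _ FD'; apply: DD => //; exact: DD'.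
    by exists D => //; have [[DD _] _ _] := FQ _ FD; apply: DD => //; exact: D'D.
  - by move=> [D FD D0]; have [_ + _] := FQ _ FD; exact.
  - have [F0|/set0P[x [D FD Dx]]] := eqVneq (\bigcup_(D in F) D) set0; first by left.
    right; have [_ _ [D0|KD]] := FQ _ FD; first by move: Dx; rewrite D0.
    by move=> k Kk; exists D => //; exact: KD.
have {}PK : K `<=` P.
  case: PK => // P_0; exfalso; apply: (Pmax K); last by split => //; right.
  rewrite P_0; split; first exact: sub0set.
  by case: Kn => k Kk /(_ _ Kk).
exists P; split => // x; apply/or_asboolP; rewrite -implyNb; apply/implyP.
move=> /asboolPn Px; apply/asboolP => q Pq.
pose D := [set y | exists r t, [/\ P r, 0 <= t & y = r + t *: x]].
have PD : P `<=` D by move=> r Pr; exists r, 0; rewrite scale0r addr0.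
have QD : Q D.
  case: Pc => PD' PZ; split; last by right; exact: subset_trans PD.
  - split=> [y y' [r [t [Pr t0 ->]]] [r' [t' [Pr' t'0 ->]]]
           |s y s0 [r [t [Pr t0 ->]]]].
      exists (r + r'), (t + t'); split; [exact: PD'|exact: addr_ge0|].
      by rewrite scalerDl addrACA.
    exists (s *: r), (s * t); split; [exact: PZ|by rewrite mulr_ge0// ltW|].
    by rewrite scalerDr scalerA.
  - move=> [r [t [Pr t0 r0]]]; move: t0; rewrite le_eqVlt => /predU1P[t0|t0].
      by apply: P0; move: r0; rewrite -t0 scale0r addr0 => ->.
    apply: Px; have -> : - x = t^-1 *: r; last by apply: PZ => //; rewrite invr_gt0.
    apply/eqP; rewrite -(inj_eq (scalerI (lt0r_neq0 t0))) scalerA divff ?lt0r_neq0//.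
    by rewrite scale1r scalerN eq_sym -addr_eq0 -r0.
apply: contrapT => nPqx; apply: (Pmax D) => //; split => // DP.
by apply: nPqx; apply: DP; exists q, 1; rewrite scale1r.
Qed.

End Separation.

Section Hyperplane.
Context {R : realType} {X : normedModType R}.
Variables (P : set X) (u : X) (d : R).
Hypotheses (d0 : 0 < d) (Pc : convex_cone P) (P0 : ~ P 0).
Hypothesis Pu : forall y, `|y| < d -> P (u + y).
Hypothesis Pdich : forall x, P (- x) \/ forall q, P q -> P (q + x).

Let PD x y : P x -> P y -> P (x + y). Proof. by case: Pc => + _; exact. Qed.
Let PZ t x : 0 < t -> P x -> P (t *: x). Proof. by case: Pc => _; exact. Qed.

Let Pu0 : P u. Proof. by rewrite -[u]addr0; apply: Pu; rewrite normr0. Qed.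

Let Pud e x : 0 < e -> `|x| < e * d -> P (e *: u + x).
Proof.
move=> e0 xe; have -> : e *: u + x = e *: (u + e^-1 *: x).
  by rewrite scalerDr scalerA divff ?lt0r_neq0// scale1r.
apply: PZ => //; apply: Pu.
by rewrite normrZ gtr0_norm ?invr_gt0// mulrC ltr_pdivrMr// mulrC.
Qed.

Let half (e : R) (x : X) : e *: x = (e / 2) *: x + (e / 2) *: x.
Proof. by rewrite -scalerDl -splitr. Qed.

(** When [P] contains a ball around [u], these are the [x] in the closure of
    both [P] and [- P]: the kernel of the functional that [P] determines. *)
Definition cone_boundary : set X :=
  [set x | forall e, 0 < e -> P (e *: u + x) /\ P (e *: u - x)].

Lemma cone_boundary_subspace : is_subspace cone_boundary.
Proof.
have H0 : cone_boundary 0.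
  by move=> e e0; rewrite subr0 addr0; split; exact: PZ.
have HN x : cone_boundary x -> cone_boundary (- x).
  by move=> Hx e e0; have [] := Hx e e0; rewrite opprK.
have HZ t x : 0 < t -> cone_boundary x -> cone_boundary (t *: x).
  move=> t0 Hx e e0.
  have te0 : 0 < t^-1 * e by rewrite mulr_gt0 ?invr_gt0.
  have [H1 H2] := Hx _ te0.
  have et : e *: u = t *: ((t^-1 * e) *: u).
    by rewrite scalerA mulrA divff ?lt0r_neq0// mul1r.
  by rewrite et -scalerDr -scalerBr; split; exact: PZ.
have HD x y : cone_boundary x -> cone_boundary y -> cone_boundary (x + y).
  move=> Hx Hy e e0; have e20 : 0 < e / 2 by rewrite divr_gt0.
  have [x1 x2] := Hx _ e20; have [y1 y2] := Hy _ e20.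
  by rewrite half; split; [rewrite addrACA|rewrite opprD addrACA]; exact: PD.
apply/is_subspaceP; split => // a x y Hx Hy; apply: HD => //.
have [a0|a0|->] := ltrgt0P a; last by rewrite scale0r.
- exact: HZ.
- by rewrite -[a]opprK scaleNr; apply: HN; apply: HZ => //; rewrite oppr_gt0.
Qed.

(** A small error [x - y] is absorbed by half of the multiple of [u], because
    [u] is an interior point of [P]. *)
Lemma cone_boundary_closed : closed cone_boundary.
Proof.
apply: closed_dist => x Hx e e0; have e20 : 0 < e / 2 by rewrite divr_gt0.
have [y Hy xy] := Hx (e / 2 * d) (mulr_gt0 e20 d0).
have [y1 y2] := Hy _ e20; rewrite half; split.
  rewrite -[X in _ + X](subrK y) addrACA.
  by apply: PD => //; exact: Pud.
rewrite -[X in _ + X](addrNK (- y)) addrACA; apply: PD => //; apply: Pud => //.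
by rewrite opprK addrC distrC.
Qed.

(** The coefficient of [u], that is the value at [x] of the separating
    functional, is the supremum of the [t] for which [x - t u] is in [P]. *)
Lemma cone_boundary_codim x : exists c, cone_boundary (x - c *: u).
Proof.
pose S := [set t | P (x - t *: u)].
have SN t s : S t -> s < t -> S s.
  move=> St st; rewrite /S/=.
  have -> : x - s *: u = (x - t *: u) + (t - s) *: u by rewrite scalerBl addrA subrK.
  by apply: PD => //; apply: PZ => //; rewrite subr_gt0.
have exlarge : exists2 e, 0 < e & `|x| < e * d.
  exists ((`|x| + 1) / d); first by rewrite divr_gt0// ltr_wpDl.
  by rewrite divfK ?lt0r_neq0// ltrDl.
have [e e0 xe] := exlarge.
have Sn0 : S !=set0 by exists (- e); rewrite /S/= scaleNr opprK addrC; exact: Pud.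
have Sub : has_ubound S.
  exists e => t St; rewrite leNgt; apply/negP => et; apply: P0.
  have := SN _ _ St et; rewrite /S/= => xeu.
  rewrite -(subrr (x - e *: u)) opprB; apply: PD => //.
  by apply: Pud; rewrite ?normrN.
have Ssup : has_sup S by [].
exists (sup S) => f f0; split.
  have [t St tS] := sup_adherent f0 Ssup.
  have -> : f *: u + (x - sup S *: u) = x - (sup S - f) *: u.
    by rewrite scalerBl opprB addrCA addrC -addrA addrC.
  exact: SN St tS.
pose y := x - (sup S + f / 2) *: u.
have f20 : 0 < f / 2 by rewrite divr_gt0.
have Py : ~ P y.
  move=> Sy; have : S (sup S + f / 2) by [].
  by move=> /(ub_le_sup Sub); rewrite gerDl leNgt f20.
have [|] := Pdich (- y); first by rewrite opprK.
move=> /(_ ((f / 2) *: u) (PZ _ _ f20 Pu0)).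
have -> : (f / 2) *: u - y = f *: u - (x - sup S *: u); last by [].
by rewrite /y !opprB scalerDl [in RHS]half -!addrA; congr (_ + _); rewrite addrCA.
Qed.

Lemma cone_boundary_interior x e : 0 < e -> (forall y, `|y| < e -> P (x + y)) ->
  ~ cone_boundary x.
Proof.
move=> e0 Px Hx.
have [s s0 su] : exists2 s, 0 < s & `|s *: u| < e.
  exists (e / (`|u| + 1)); first by rewrite divr_gt0// ltr_wpDl.
  rewrite normrZ gtr0_norm ?divr_gt0 ?ltr_wpDl//.
  by rewrite mulrAC ltr_pdivrMr ?ltr_wpDl// ltr_pM2l// ltrDl.
apply: P0; rewrite -(subrr (x - s *: u)) opprB; apply: PD.
  by apply: Px; rewrite normrN.
by have [] := Hx _ s0.
Qed.

End Hyperplane.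

(** Apply the construction to the cone over [A - z] thickened by a ball, whose
    radius [d] is a lower bound for the distance of [z] to [A], so that the cone
    omits [0] and has the points of [A - z] in its interior. *)
Lemma separating_hyperplane (R : realType) (X : normedModType R) (A : set X) z :
  closed A -> @convex_set R X A -> A !=set0 -> ~ A z ->
  exists H : set X, [/\ is_subspace H, closed H,
    exists u, forall x, exists c, H (x - c *: u) & forall h, H h -> ~ A (z + h)].
Proof.
move=> Acl /convex_setP Acv [a0 Aa0] Az.
have [d d0 Ad] := closed_avoid _ _ Acl Az.
pose K : set X := [set x | exists t a,
  [/\ 0 < t, A a & `|x - t *: (a - z)| < t * d]].
have Kc : convex_cone K.
  split=> [x y [t [a [t0 Aa xt]]] [s [b [s0 Ab ys]]]|s x s0 [t [a [t0 Aa xt]]]].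
    have ts0 : 0 < t + s by exact: addr_gt0.
    have ts1 : t + s != 0 by rewrite lt0r_neq0.
    exists (t + s), ((t / (t + s)) *: a + (1 - t / (t + s)) *: b); split => //.
      apply: Acv => //; apply/andP; split; first by apply: divr_ge0; exact: ltW.
      by rewrite ler_pdivrMr// mul1r lerDl; exact: ltW.
    have -> : x + y - (t + s) *:
          (t / (t + s) *: a + (1 - t / (t + s)) *: b - z) =
        (x - t *: (a - z)) + (y - s *: (b - z)).
      rewrite [RHS]addrACA -opprD; congr (_ - _).
      rewrite !scalerBr !scalerDr !scalerA mulrBr mulr1 mulrCA divff// mulr1.
      by rewrite (addrC t s) addrK scalerDl opprD (addrC (- (s *: z))) addrACA.
    by rewrite mulrDl (le_lt_trans (ler_normD _ _))// ltrD.
  exists (s * t), a; split => //; first exact: mulr_gt0.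
  by rewrite -scalerA -scalerBr normrZ gtr0_norm// -mulrA ltr_pM2l.
have Kin a y : A a -> `|y| < d -> K (a - z + y).
  by move=> Aa yd; exists 1, a; split => //; rewrite scale1r mul1r addrC addKr.
have K0 : ~ K 0.
  move=> [t [a [t0 Aa]]]; rewrite sub0r normrN normrZ gtr0_norm// ltr_pM2l//.
  by rewrite ltNge Ad.
have Kn : K !=set0 by exists (a0 - z + 0); apply: Kin; rewrite ?normr0.
have [P [Pc KP P0 Pd]] := maximal_cone _ Kc Kn K0.
have Pin a y : A a -> `|y| < d -> P (a - z + y) by move=> Aa yd; apply/KP/Kin.
have Pu y := Pin _ y Aa0.
exists (cone_boundary P (a0 - z)); split.
- exact: cone_boundary_subspace d0 Pc Pu.
- exact: cone_boundary_closed d0 Pc Pu.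
- by exists (a0 - z); exact: cone_boundary_codim d0 Pc P0 Pu Pd.
- move=> h Hh Azh; apply: (cone_boundary_interior _ _ Pc P0 _ _ d0 _ Hh) => y yd.
  by have := Pin _ _ Azh yd; rewrite (addrC z) addrK.
Qed.

(** * Restriction to a set of coordinates in an l_p sum *)

Section Restriction.
Context {R : realType} {p : R} {p1 : 1 <= p} {E : nat -> normedModType R}.
Local Notation Z := (lp_sum E p1).
Implicit Types (S : pred nat) (x y z : Z).

Let p0 : 0 < p. Proof. exact: lt_le_trans p1. Qed.

Lemma lp_massE x : (`|x| `^ p)%:E = lp_mass p x.
Proof.
have xfin : lp_mass p x \is a fin_num.
  by rewrite ge0_fin_numE ?lp_mass_ge0//; have := lp_seqP x; rewrite inE.
rewrite lp_sum_normE lp_norm.unlock -powRrM mulVf ?gt_eqF// powRr1 ?fineK//.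
by rewrite fine_ge0// lp_mass_ge0.
Qed.

Lemma lp_sum_ext x y : (forall i, lp_seq x i = lp_seq y i) -> x = y.
Proof. by move=> xy; apply/val_inj/functional_extensionality_dep. Qed.

Definition seq_restr S (x : dprod E) : dprod E := fun i => if S i then x i else 0.

Lemma seq_restr_summable S x : seq_restr S x \in @lp_summable R p E.
Proof.
have := lp_seqP x; rewrite !inE/=; apply: le_lt_trans.
rewrite lp_mass.unlock; apply: lee_nneseries => i _.
  by rewrite lee_fin powR_ge0.
rewrite lee_fin /seq_restr; case: (S i) => //.
by rewrite normr0 powR0 ?powR_ge0// gt_eqF.
Qed.

Definition restr S x : Z := @LpSum R p E p1 _ (seq_restr_summable S x).

Lemma restrE S x i : lp_seq (restr S x) i = if S i then lp_seq x i else 0.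
Proof. by []. Qed.


Lemma restr_linear S : linear (restr S).
Proof.
move=> a x y; apply: lp_sum_ext => i.
rewrite restrE !lp_seqD !lp_seqZ !dprodDE !dprodZE !restrE.
by case: (S i); rewrite // scaler0 addr0.
Qed.

HB.instance Definition _ S :=
  GRing.isLinear.Build R Z Z _ (restr S) (restr_linear S).

(** A function with its own name, so that it carries a linear structure. *)
Definition coord i z : E i := lp_seq z i.

Lemma coord_linear i : linear (coord i).
Proof. by move=> a x y; rewrite /coord lp_seqD lp_seqZ. Qed.

HB.instance Definition _ i :=
  GRing.isLinear.Build R Z (E i) _ (coord i) (coord_linear i).

Lemma coord_restr i S z : coord i (restr S z) = if S i then coord i z else 0.
Proof. by []. Qed.

Lemma norm_powD x y : (forall i, lp_seq x i = 0 \/ lp_seq y i = 0) ->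
  `|x + y| `^ p = `|x| `^ p + `|y| `^ p.
Proof.
move=> xy; apply/EFin_inj; rewrite EFinD !lp_massE lp_mass.unlock.
rewrite -nneseriesD; do 1?[by move=> i _ _; rewrite lee_fin powR_ge0].
apply: eq_eseriesr => i _; rewrite lp_seqD dprodDE -EFinD.
by have [->|->] := xy i; rewrite normr0 powR0 ?gt_eqF// ?add0r ?addr0.
Qed.

Lemma norm_le_pow x y : `|x| `^ p <= `|y| `^ p -> `|x| <= `|y|.
Proof.
by apply: contraTT; rewrite -!ltNge => /gt0_ltr_powR; apply; rewrite ?nnegrE.
Qed.

Lemma restr_split S z : z = restr S z + restr (predC S) z.
Proof.
apply: lp_sum_ext => i; rewrite lp_seqD dprodDE !restrE/=.
by case: (S i); rewrite ?addr0 ?add0r.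
Qed.

Lemma restr_le S z : `|restr S z| <= `|z|.
Proof.
apply: norm_le_pow; rewrite [in leRHS](restr_split S z) norm_powD.
  by rewrite lerDl powR_ge0.
by move=> i; rewrite !restrE/=; case: (S i); [right|left].
Qed.

Lemma restr_subset S S' z : (forall i, S i -> S' i) ->
  `|restr S z| <= `|restr S' z|.
Proof.
move=> SS'; have -> : restr S z = restr S (restr S' z); last exact: restr_le.
apply: lp_sum_ext => i; rewrite !restrE.
by case: ifP => // /SS' ->.
Qed.

Lemma restr_colour_sum n (col : nat -> 'I_n) z :
  \sum_(k < n) `|restr (fun i => col i == k) z| `^ p = `|z| `^ p.
Proof.
apply/EFin_inj; rewrite -sumEFin.
under eq_bigr do rewrite lp_massE lp_mass.unlock.
rewrite lp_massE lp_mass.unlock -nneseries_sum; last first.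
  by move=> i j _; rewrite lee_fin powR_ge0.
apply: eq_eseriesr => i _.
rewrite (bigD1 (col i))// restrE eqxx big1 => [|k /negbTE ki].
  by rewrite /= adde0.
by rewrite restrE eq_sym ki normr0 powR0// gt_eqF.
Qed.

Lemma restr_tail z e : 0 < e -> exists N, forall M, (N <= M)%N ->
  `|restr (leq M) z| < e.
Proof.
move=> e0; pose f i := (`|lp_seq z i| `^ p)%:E.
have f0 k : true -> (0 <= f k)%E by rewrite lee_fin powR_ge0.
have zfin : (\sum_(0 <= k <oo | true) f k < +oo)%E.
  by have := lp_seqP z; rewrite inE/= lp_mass.unlock.
have := nneseries_tail_cvg zfin f0.
move=> /fine_cvgP[tfin /cvgr_lt/(_ (e `^ p))]; rewrite powR_gt0// => /(_ isT) te.
have [N _ NP] := filterI tfin te.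
exists N => M /NP[/= Mfin]; rewrite -lte_fin fineK// => Me.
apply: contraTT Me; rewrite -!leNgt => /(ge0_ler_powR (ltW p0)).
rewrite !nnegrE ltW// normr_ge0 => /(_ isT isT).
rewrite -lee_fin => /le_trans; apply.
rewrite lp_massE lp_mass.unlock [leRHS]eseries_cond [leRHS]eseries_mkcond.
apply: lee_nneseries => i _; first by rewrite lee_fin powR_ge0.
rewrite restrE /f; case: (M <= i)%N => //.
by rewrite normr0 powR0 ?gt_eqF.
Qed.

End Restriction.
Arguments restr : simpl never.
Arguments coord : simpl never.

(** * Vectors of [X] whose image has vanishing first coordinates *)

Section Embedding.
Context {R : realType} {p : R} {p1 : 1 <= p} {E : nat -> normedModType R}.
Context {X : normedModType R}.
Local Notation Z := (lp_sum E p1).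
Variables (T : {linear X -> Z}) (a b : R).
Hypotheses (a0 : 0 < a) (b0 : 0 < b).
Hypothesis Tbounds : forall x, a * `|x| <= `|T x| <= b * `|x|.

Let p0 : 0 < p. Proof. exact: lt_le_trans p1. Qed.

Let T_ge x : a * `|x| <= `|T x|. Proof. by case/andP: (Tbounds x). Qed.
Let T_le x : `|T x| <= b * `|x|. Proof. by case/andP: (Tbounds x). Qed.

Lemma closed_restr_sublevel S t : closed [set x | `|restr S (T x)| <= t].
Proof.
apply: (closed_sublevel _ b _ b0) => x y.
rewrite (le_trans (lerB_dist _ _))// -!linearB.
exact: le_trans (restr_le _ _) (T_le _).
Qed.

Definition null_coords N : set X :=
  [set x | forall i, (i < N)%N -> coord i (T x) = 0].

Lemma null_coords_subspace N : is_subspace (null_coords N).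
Proof.
apply/is_subspaceP; split=> [i _|c x y Nx Ny i iN]; first by rewrite !linear0.
rewrite !linearP/= (Nx i iN : coord i (T x) = 0).
by rewrite (Ny i iN : coord i (T y) = 0) scaler0 addr0.
Qed.

Lemma null_coordsE N : null_coords N = [set x | `|restr (ltn^~ N) (T x)| <= 0].
Proof.
apply/seteqP; split=> x /=; rewrite normr_le0 => Nx.
  apply/eqP/lp_sum_ext => i; rewrite restrE lp_seq0 dprod0E.
  by case: ifP => // iN; exact: Nx.
move=> i iN; have : coord i (restr (ltn^~ N) (T x)) = 0.
  by rewrite (eqP Nx) linear0.
by rewrite /coord restrE /= iN.
Qed.

Lemma null_coords_closed N : closed (null_coords N).
Proof. by rewrite null_coordsE; exact: closed_restr_sublevel. Qed.

Lemma null_coords_fcodim N (Y : set X) : (forall i, finite_dimensional (E i)) ->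
  is_subspace Y -> finite_codimensional Y ->
  finite_codimensional (Y `&` null_coords N).
Proof.
move=> Efin Ys Yf; elim: N => [|N IH].
  by apply: fcodim_sub Yf => x Yx; split => // i.
have YNs : is_subspace (Y `&` null_coords N).
  by apply: subspaceI => //; exact: null_coords_subspace.
have := fcodim_ker _ _ (coord N \o T) (Efin N) YNs IH.
apply: fcodim_sub => x [[Yx Nx] gx]; split => // i.
rewrite ltnS leq_eqVlt => /predU1P[->//|].
exact: Nx.
Qed.

(** * Thin convex sets do not cover the ball *)

Section Lower.
Variables (n : nat) (A : 'I_n -> set X) (r : R).
Hypothesis r0 : 0 < r.
Hypothesis Efin : forall i, finite_dimensional (E i).
Hypothesis Acl : forall k, closed (A k).
Hypothesis Acv : forall k, @convex_set R X (A k).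
Hypothesis Acover : @unit_ball R X `<=` \bigcup_k A k.
Hypothesis Athin : forall k x (Y : set X), A k x -> closed Y -> is_subspace Y ->
  finite_codimensional Y -> exists y, [/\ Y y, `|y| <= 1 & ~ A k (x + r *: y)].
Hypothesis rsmall : n%:R * (b * r) `^ p <= (a / 2) `^ p.

(** The state after [j] steps: the point [x] and every [x + h] with [h] in [Y]
    avoid the sets indexed by [K].  The vector [w] is a finitely supported
    approximation of [T x]; measuring with [w] keeps the p-th powers exactly
    additive, at the price of an error [e] per step for the cut off tail. *)
Lemma thin_cover_escape e j : 0 < e -> n%:R * e <= a / 2 -> (j <= n)%N ->
  exists x w N (Y : set X) (K : {set 'I_n}),
  [/\ [/\ `|x| <= 1, `|T x - w| <= j%:R * e, `|w| `^ p <= j%:R * (b * r) `^ p &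
        forall i, (N <= i)%N -> coord i w = 0],
      [/\ is_subspace Y, closed Y & finite_codimensional Y] &
      (j <= #|K|)%N /\ forall k h, k \in K -> Y h -> ~ A k (x + h)].
Proof.
move=> e0 en; elim: j => [_|j IH jn].
  exists 0, 0, 0%N, setT, finset.set0; split; split => //.
  - by rewrite normr0.
  - by rewrite linear0 subrr normr0 mul0r.
  - by rewrite normr0 powR0 ?mul0r// gt_eqF.
  - exact: subspace_setT.
  - exact: fcodim_setT.
  - by move=> k h; rewrite inE.
have [x [w [N [Y [K [[x1 xw wp wN] [Ys Yc Yf] [jK KA]]]]]]] := IH (ltnW jn).
have [k _ Akx] := Acover _ x1.
have kK : k \notin K.
  apply/negP => kK; apply: (KA k 0) => //; last by rewrite addr0.
  exact: subspace0.
pose Y' := Y `&` null_coords N.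
have Y's : is_subspace Y' by apply: subspaceI => //; exact: null_coords_subspace.
have Y'c : closed Y' by apply: closedI => //; exact: null_coords_closed.
have Y'f : finite_codimensional Y' by exact: null_coords_fcodim.
have [y [[Yy Ny] y1 Axy]] := Athin _ _ _ Akx Y'c Y's Y'f.
(* All later points lie in [x + r *: y + H], hence outside [A k]. *)
have [H [Hs Hc [u Hu] HA]] := separating_hyperplane _ _ _ _ (Acl k) (Acv k)
  (ex_intro _ x Akx) Axy.
have [M Mtail] := restr_tail (T (r *: y)) e e0.
pose L := maxn N M.
have Try : `|T (r *: y)| <= b * r.
  apply: le_trans (T_le _) _; rewrite ler_pM2l// normrZ gtr0_norm//.
  by rewrite ler_piMr// ltW.
pose v := restr (ltn^~ L) (T (r *: y)).
have vN i : (i < N)%N -> coord i v = 0.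
  move=> iN; rewrite coord_restr !linearZ/=.
  by rewrite (Ny i iN : coord i (T y) = 0) scaler0; case: ifP.
have Tv : T (r *: y) - v = restr (leq L) (T (r *: y)).
  rewrite {1}[T _](restr_split (ltn^~ L)) /v addrAC subrr add0r.
  by apply: lp_sum_ext => i; rewrite !restrE/= -leqNgt.
have wv : `|w + v| `^ p <= j.+1%:R * (b * r) `^ p.
  rewrite norm_powD; last first.
    move=> i; have [Ni|iN] := leqP N i; first by left; exact: wN.
    by right; exact: vN.
  rewrite -addn1 natrD mulrDl mul1r lerD// ge0_ler_powR ?nnegrE ?(ltW p0)//.
    by rewrite mulr_ge0// ltW.
  exact: le_trans (restr_le _ _) Try.
have xwv : `|T (x + r *: y) - (w + v)| <= j.+1%:R * e.
  rewrite linearD opprD addrACA -addn1 natrD mulrDl mul1r.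
  apply: le_trans (ler_normD _ _) _; apply: lerD => //.
  by rewrite Tv ltW// Mtail// leq_maxr.
exists (x + r *: y), (w + v), L, (Y `&` H), (k |: K)%SET; split; split => //.
- have wva : `|w + v| <= a / 2.
    have : `|w + v| `^ p <= (a / 2) `^ p.
      apply: le_trans wv (le_trans _ rsmall).
      by rewrite ler_wpM2r ?powR_ge0// ler_nat.
    apply: contraTT; rewrite -!ltNge => /gt0_ltr_powR; apply; rewrite ?nnegrE//.
    by rewrite divr_ge0// ltW.
  rewrite -(ler_pM2l a0) mulr1; apply: le_trans (T_ge _) _.
  rewrite -[T _](subrK (w + v)) [leRHS]splitr.
  apply: le_trans (ler_normD _ _) _; apply: lerD => //.
  by apply: le_trans xwv (le_trans _ en); rewrite ler_wpM2r ?ler_nat// ltW.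
- move=> i Li; rewrite linearD /= wN ?add0r; last first.
    by apply: leq_trans Li; exact: leq_maxl.
  by rewrite coord_restr /= ltnNge Li.
- exact: subspaceI.
- exact: closedI.
- exact: fcodim_capH Hu Yf.
- by rewrite cardsU1 kK.
- move=> l h; rewrite in_setU1 => /predU1P[->|lK] [Yh Hh].
    exact: HA.
  rewrite -addrA; apply: KA => //; apply: subspaceD => //.
  exact: subspaceZ.
Qed.

Lemma no_thin_cover : False.
Proof.
have e0 : 0 < a / 2 / n.+1%:R by rewrite !divr_gt0.
have en : n%:R * (a / 2 / n.+1%:R) <= a / 2.
  rewrite mulrCA ger_pMr ?divr_gt0// ler_pdivrMr// mul1r ler_nat//.
have [x [w [N [Y [K [[x1 _ _ _] [Ys _ _] [nK KA]]]]]]] :=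
  thin_cover_escape _ _ e0 en (leqnn n).
have [k _ Akx] := Acover _ x1.
apply: (KA k 0); last by rewrite addr0.
  suff -> : K = finset.setT by rewrite finset.in_setT.
  by apply/eqP; rewrite eqEcard finset.subsetT cardsT card_ord.
exact: subspace0.
Qed.

End Lower.

(** * A gliding hump sequence and the seminorms of its colours *)

Section Upper.
Hypothesis Efin : forall i, finite_dimensional (E i).
Hypothesis Xinf : ~ finite_dimensional X.

Let start_witness N : exists2 x, null_coords N x & `|x| = 1.
Proof.
have NT : finite_codimensional (null_coords N).
  apply: fcodim_sub (null_coords_fcodim N _ Efin subspace_setT fcodim_setT).
  by move=> x [].
have [y Ny y0] := fcodim_nonzero _ Xinf NT.
exists (`|y|^-1 *: y); first exact: subspaceZ (null_coords_subspace N) _ _ Ny.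
by rewrite normrZ normfV normr_id mulVf// normr_eq0.
Qed.

Definition unit_start N : X := projT1 (cid2 (start_witness N)).

Lemma unit_startP N : null_coords N (unit_start N) /\ `|unit_start N| = 1.
Proof. by rewrite /unit_start; case: cid2. Qed.

(** Summable with sum at most [a / 4], also along every subsequence. *)
Definition tol (j : nat) : R := a / 4 / 2 ^+ j.+1.

Lemma tol_gt0 j : 0 < tol j.
Proof. by rewrite /tol !divr_gt0// exprn_gt0. Qed.

Let end_witness j N : exists M, (N <= M)%N /\
  `|restr (leq M) (T (unit_start N))| < tol j.
Proof.
have [M Mtail] := restr_tail (T (unit_start N)) _ (tol_gt0 j).
by exists (maxn N M); split; [exact: leq_maxl|apply: Mtail; exact: leq_maxr].
Qed.

(** The block boundaries.  The vector of a block depends only on where the block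
    starts, and the block ends where little of the image of this vector is
    left. *)
Fixpoint cut j : nat :=
  if j is j'.+1 then projT1 (cid (end_witness j' (cut j'))) else 0%N.

Definition block_vec j : X := unit_start (cut j).

Definition block j : pred nat := fun i => (cut j <= i < cut j.+1)%N.

Lemma leq_cut : {homo cut : i j / (i <= j)%N}.
Proof.
apply: homo_leq => [//||j]; first exact: leq_trans.
by rewrite /cut -/cut; case: cid => M [].
Qed.

Lemma block_vec_tail j : `|restr (leq (cut j.+1)) (T (block_vec j))| < tol j.
Proof. by rewrite /cut -/cut /block_vec; case: cid => M []. Qed.

Lemma block_vec_start j i : (i < cut j)%N -> coord i (T (block_vec j)) = 0.
Proof. by move=> ij; have [+ _] := unit_startP (cut j); exact. Qed.

Lemma norm_block_vec j : `|block_vec j| = 1.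
Proof. by have [] := unit_startP (cut j). Qed.

Lemma block_inj i j l : block j i -> block l i -> j = l.
Proof.
move=> /andP[ji ij] /andP[li il]; apply/eqP; rewrite eqn_leq; apply/andP.
by split; rewrite leqNgt; apply/negP => /leq_cut h;
  [move: (leq_trans il h)|move: (leq_trans ij h)]; rewrite ltnNge ?ji ?li.
Qed.

(** Off its block the image vanishes below and is a small tail above. *)
Lemma block_vec_off_block j S : (forall i, block j i -> ~~ S i) ->
  `|restr S (T (block_vec j))| < tol j.
Proof.
move=> Sj; apply: le_lt_trans (block_vec_tail j).
have -> : restr S (T (block_vec j)) = restr S (restr (leq (cut j.+1)) (T (block_vec j))).
  apply: lp_sum_ext => i; rewrite !restrE.
  case Si : (S i) => //; case: leqP => // ij1.
  have [ji|/block_vec_start//] := leqP (cut j) i.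
  by have := Sj i; rewrite /block ji ij1 Si => /(_ isT).
exact: restr_le.
Qed.

Lemma block_vec_on_block j : a - tol j <= `|restr (block j) (T (block_vec j))|.
Proof.
have aT : a <= `|T (block_vec j)| by have := T_ge (block_vec j); rewrite norm_block_vec mulr1.
rewrite lerBlDr (le_trans aT)// {1}[T _](restr_split (block j)).
rewrite (le_trans (ler_normD _ _))// lerD// ltW// block_vec_off_block// => i /= ->.
by [].
Qed.

Definition block_index (i : nat) : nat := xget 0%N [set j | block j i].

Lemma block_indexE j i : block j i -> block_index i = j.
Proof.
by move=> ij; apply: xget_unique => //= l il; exact: block_inj il ij.
Qed.

(** The tolerances decrease and [i * n + k >= i], so the sum is dominated by
    the geometric series with ratio [1 / 2]. *)
Lemma tol_sum n m k : (0 < n)%N -> \sum_(i < m) tol (i * n + k) <= a / 4.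
Proof.
move=> n0; have a4 : 0 < a / 4 by rewrite divr_gt0.
apply: (@le_trans _ _ (a / 4 * (1 - 1 / 2 ^+ m))); last first.
  by rewrite ger_pMr// lerBlDr lerDl divr_ge0// exprn_ge0.
elim: m => [|m IH]; first by rewrite big_ord0 expr0 divr1 subrr mulr0.
rewrite big_ord_recr/=; have := lerD IH (_ : tol (m * n + k) <= a / 4 / 2 ^+ m.+1).
move=> /(_ _)/le_trans; apply.
  rewrite /tol ler_pM2l// lef_pV2 ?posrE ?exprn_gt0// ler_eXn2l ?ltr1n//.
  by rewrite ltnS (leq_trans (leq_pmulr m n0))// leq_addr.
rewrite -mulrDr ler_pM2l// exprS invfM div1r mul1r.
by have h : 0 < (2 ^+ m : R)^-1; [rewrite invr_gt0 exprn_gt0|lra].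
Qed.

Section Colour.
Variables (n : nat) (n0 : (0 < n)%N).

Definition colour (i : nat) : 'I_n := Ordinal (ltn_pmod (block_index i) n0).

Lemma colour_block j i : block j i -> val (colour i) = (j %% n)%N.
Proof. by move=> /block_indexE /= ->. Qed.

(** Let [y] be a combination in [Y] of block vectors of colour [k], with
    coefficients at most [M] in modulus and equal to [M] at [i0].  Off colour [k]
    its image has norm at most [M a / 4].  On the block of [i0] alone the image
    has norm at least [3 / 4 M a], so the part of colour [k] is at least three
    times the rest and therefore carries 3/4 of the norm of [T y], which is at
    least [a * `|y|]. *)
Lemma colour_detects (k : 'I_n) (Y : set X) : is_subspace Y ->
  finite_codimensional Y ->
  exists y, [/\ Y y, `|y| = 1 &
    3 / 4 * a <= `|restr (fun i => colour i == k) (T y)|].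
Proof.
move=> Ys Yf; have [m /(_ (fun i => block_vec (i * n + k)))] := fcodim_comb _ Ys Yf.
move=> [c Yc [i1 ci1]].
pose f (i : 'I_m) := (i * n + k)%N.
have fk i : (f i %% n)%N = k by rewrite /f modnMDl modn_small.
have finj i j : f i = f j -> i = j.
  move=> /addIn /eqP; rewrite eqn_pmul2r// => /eqP ij; exact/val_inj.
pose y := \sum_(i < m) c i *: block_vec (f i).
have Yy : Y y by [].
pose i0 := [arg max_(i > i1) `|c i|]%O.
have cmax i : `|c i| <= `|c i0|.
  by rewrite /i0; case: arg_maxP => // j _; exact.
have M0 : 0 < `|c i0| by apply: lt_le_trans (cmax i1); rewrite normr_gt0.
pose S i := colour i == k.
have fS i l : block (f i) l -> S l.
  by move=> lf; apply/eqP/val_inj; rewrite (colour_block _ _ lf) fk.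
have Ty : T y = \sum_(i < m) c i *: T (block_vec (f i)).
  by rewrite linear_sum; apply: eq_bigr => i _; rewrite linearZ.
have csum : \sum_(i < m) `|c i| * tol (f i) <= `|c i0| * (a / 4).
  apply: le_trans (_ : `|c i0| * \sum_(i < m) tol (f i) <= _).
    by rewrite mulr_sumr ler_sum// => i _; rewrite ler_wpM2r// ltW// tol_gt0.
  by rewrite ler_pM2l// tol_sum.
have off : `|restr (predC S) (T y)| <= `|c i0| * (a / 4).
  apply: (le_trans _ csum); rewrite Ty linear_sum.
  apply: le_trans (ler_norm_sum _ _ _) _; apply: ler_sum => i _.
  rewrite linearZ normrZ ler_wpM2l// ltW// block_vec_off_block// => l lf /=.
  by rewrite negbK; exact: fS lf.
have on : `|c i0| * (3 / 4 * a) <= `|restr S (T y)|.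
  apply: le_trans (restr_subset (block (f i0)) S (T y) _); last first.
    by move=> l; exact: fS.
  rewrite Ty linear_sum (bigD1 i0)//=.
  apply: le_trans (lerB_normD _ _).
  rewrite linearZ/= normrZ.
  have h1 := ler_wpM2l (ltW M0) (block_vec_on_block (f i0)).
  have h2 : `|\sum_(i < m | i != i0) restr (block (f i0)) (c i *: T (block_vec (f i)))|
     <= \sum_(i < m | i != i0) `|c i| * tol (f i).
    apply: le_trans (ler_norm_sum _ _ _) _; apply: ler_sum => i ii0.
    rewrite linearZ normrZ ler_wpM2l// ltW// block_vec_off_block// => l lf.
    apply/negP => lf0; move/eqP: ii0; apply; apply: finj.
    exact: block_inj lf lf0.
  have := csum; rewrite (bigD1 i0)//= => h3.
  lra.
have yq : 3 / 4 * a * `|y| <= `|restr S (T y)|.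
  have h1 := T_ge y.
  have h2 : `|T y| <= `|restr S (T y)| + `|restr (predC S) (T y)|.
    by rewrite {1}(restr_split S (T y)) ler_normD.
  have -> : 3 / 4 * a * `|y| = 3 / 4 * (a * `|y|) by rewrite mulrA.
  lra.
have y0 : 0 < `|y|.
  rewrite normr_gt0; apply/eqP => y0; move: on.
  rewrite y0 !linear0 normr0 leNgt => /negP; apply.
  by rewrite !mulr_gt0.
exists (`|y|^-1 *: y); split; first exact: subspaceZ.
  by rewrite normrZ normfV normr_id mulVf// lt0r_neq0.
by rewrite !linearZ/= normrZ normfV normr_id ler_pdivlMl// mulrC.
Qed.

End Colour.

End Upper.

End Embedding.

(** * Estimates of the essential inradius and of the covering index *)

Section EssentialInradius.
Context {R : realType} {X : normedModType R}.
Implicit Types A : set X.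

Lemma essential_inradius_lt A (r : R) : 0 < r ->
  (essential_inradius A < r%:E)%E ->
  forall x (Y : set X), A x -> closed Y -> is_subspace Y ->
  finite_codimensional Y -> exists y, [/\ Y y, `|y| <= 1 & ~ A (x + r *: y)].
Proof.
move=> r0 Ar x Y Ax Yc Ys Yf; apply: contrapT => noy.
move: Ar; rewrite ltNge => /negP; apply; apply: ereal_sup_ubound.
right; exists r => //; split => //; exists x, Y; split => // _ [y [y1 Yy] <-].
by apply: contrapT => Axy; apply: noy; exists y.
Qed.

(** If [x + r y] and [x - r y] are both in [A], then
    [2 r * q y = q ((x + r y) - (x - r y)) <= 2 s]. *)
Lemma essential_inradius_le A (s : R) (q : X -> R) (d : R) : 0 < d ->
  (forall x y, q (x - y) <= q x + q y) ->
  (forall t x, 0 < t -> q (t *: x) = t * q x) ->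
  (forall x, A x -> q x <= s) ->
  (forall Y : set X, is_subspace Y -> finite_codimensional Y ->
    exists y, [/\ Y y, `|y| = 1 & d <= q y]) -> 0 <= s ->
  (essential_inradius A <= (s / d)%:E)%E.
Proof.
move=> d0 qB qZ Aq Yq s0; apply: ge_ereal_sup => z.
move=> [->|[r [r0 [x [Y [Ax _ Ys Yf rA]]]] <-]].
  by rewrite lee_fin divr_ge0// ltW.
have [y [Yy y1 dy]] := Yq _ Ys Yf.
have A1 : A (x + r *: y).
  by apply: rA; exists y => //; split => //; rewrite /unit_ball/= y1.
have A2 : A (x - r *: y).
  apply: rA; exists (- y); last by rewrite scalerN.
  by split; [rewrite /unit_ball/= normrN y1|rewrite -scaleN1r; exact: subspaceZ].
rewrite lee_fin ler_pdivlMr//.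
have h1 := Aq _ A1; have h2 := Aq _ A2.
have h3 := qB (x + r *: y) (x - r *: y).
have h4 : q (x + r *: y - (x - r *: y)) = 2 * r * q y.
  rewrite opprB addrC -addrA addKr.
  have -> : r *: y + r *: y = (2 * r) *: y.
    by rewrite mulr2n mulrDl mul1r scalerDl.
  by rewrite qZ// mulr_gt0.
have h5 : r * d <= r * q y by rewrite ler_pM2l.
lra.
Qed.

End EssentialInradius.

Theorem proposition4p1 (R : realType) (p : R) (p1 : 1 <= p)
    (E : nat -> normedModType R) (X : completeNormedModType R) :
  (forall i, finite_dimensional (E i)) ->
  ~ finite_dimensional X ->
  isomorphic_to_closed_subspace X (lp_sum E p1) ->
  exists c d : R, [/\ 0 < c, 0 < d &
    forall n : nat, (0 < n)%N ->
      ((c * n%:R `^ (- p^-1))%:E <= covering_index X n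
        <= (d * n%:R `^ (- p^-1))%:E)%E].
Proof.
move=> Efin Xinf [T [_ [a [b [a0 b0 Tab]]]]].
have p0 : 0 < p := lt_le_trans ltr01 p1.
exists (a / 2 / b), (b / (3 / 4 * a)); split; rewrite ?divr_gt0// ?mulr_gt0//.
move=> n n0; pose v : R := n%:R `^ (- p^-1).
have nR0 : 0 < n%:R :> R by rewrite ltr0n.
have v0 : 0 < v by exact: powR_gt0.
have vp : n%:R * v `^ p = 1.
  rewrite /v -powRrM mulNr mulVf ?gt_eqF// powR_inv1 ?ltW// divff// gt_eqF//.
apply/andP; split.
- apply: le_ereal_inf_tmp => _ [A [Acc AB] <-]; rewrite leNgt; apply/negP => Asmall.
  pose r := a / 2 / b * v.
  have r0 : 0 < r by rewrite mulr_gt0// !divr_gt0.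
  apply: (no_thin_cover T a b a0 b0 Tab n A r r0 Efin).
  + by move=> k; case: (Acc k).
  + by move=> k; case: (Acc k).
  + by rewrite AB.
  + move=> k; apply: essential_inradius_lt => //.
    by apply: le_lt_trans Asmall; exact: le_bigmax.
  + have -> : b * r = a / 2 * v by rewrite /r mulrA [b * _]mulrC divfK ?gt_eqF.
    by rewrite powRM ?(ltW v0) ?divr_ge0 ?(ltW a0)// mulrCA vp mulr1.
- pose col := colour T a a0 Efin Xinf n n0.
  pose q (k : 'I_n) x := `|restr (fun i => col i == k) (T x)|.
  pose A (k : 'I_n) := [set x : X | `|x| <= 1] `&` [set x | q k x <= b * v].
  apply: (@le_trans _ _ (\big[maxe/-oo]_(k < n) essential_inradius (A k))%E).
    apply: ereal_inf_lbound; exists A => //; split.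
    + move=> k; split.
      * exists 1; split; first exact: num_real.
        by move=> t t1 x [x1 _]; apply: le_trans x1 (ltW t1).
      * apply: closedI; last exact: closed_restr_sublevel b0 Tab _ _.
        apply: (closed_sublevel _ 1 _ ltr01) => x y.
        by rewrite mul1r lerB_dist.
      * apply: convex_setI; apply: convex_sublevel => [x y|t x t0].
        - exact: ler_normD.
        - by rewrite normrZ ger0_norm.
        - by rewrite /q !linearD ler_normD.
        - by rewrite /q !linearZ normrZ ger0_norm.
    (* If [x] were in no [A k], then all its n colour parts would exceed
       [b * v], and the p-th powers would sum to more than [b ^ p]. *)
    + apply/seteqP; split=> [x [k _ []//]|x x1].
      apply: contrapT => nox.
      have big k : b * v < q k x.
        by rewrite ltNge; apply/negP => qk; apply: nox; exists k.
      have Tb : `|T x| <= b.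
        have /andP[_ /le_trans] := Tab x; apply.
        by rewrite ger_pMr.
      have : n%:R * (b * v) `^ p < \sum_(k < n) q k x `^ p.
        rewrite mulr_natl -[X in _ *+ X](card_ord n) -sumr_const.
        apply: ltr_sum => [|k _].
          by apply/hasP; exists (Ordinal n0); rewrite ?mem_index_enum.
        apply: gt0_ltr_powR => //; rewrite nnegrE /q ?normr_ge0//.
        by rewrite mulr_ge0// ltW.
      rewrite restr_colour_sum powRM ?(ltW b0) ?(ltW v0)// mulrCA vp mulr1 ltNge.
      move=> /negP; apply; apply: ge0_ler_powR; rewrite ?nnegrE ?(ltW p0)//.
      exact: ltW.
  apply: bigmax_le => [|k _]; first by rewrite leNye.
  rewrite mulrAC; apply: (@essential_inradius_le _ _ _ _ (q k)).
  + by rewrite mulr_gt0.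
  + by move=> x y; rewrite /q !linearB ler_normB.
  + by move=> t x t0; rewrite /q !linearZ normrZ gtr0_norm.
  + by move=> x [].
  + exact: colour_detects.
  + by rewrite mulr_ge0// ltW.
Qed.
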